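(* Let $G$ be a group and let $X$ be an infinite transitive $G$-space. Then each $G$-Ramsey ultrafilter on $X$ is $G$-selective.
   Context: A $G$-space is a set $X$ with an action $(g,x)\mapsto gx$ of the group $G$; it is transitive if for any $x,y\in X$ there exists $g\in G$ with $gx=y$. $[X]^2$ denotes the set of all $2$-element subsets of $X$. A coloring $\chi:[X]^2\to\{0,1\}$ is $G$-invariant if $\chi(\{x,y\})=\chi(\{gx,gy\})$ for all $\{x,y\}\in[X]^2$ and $g\in G$. An ultrafilter is free if it is non-principal. A free ultrafilter $\mathcal{U}$ on $X$ is $G$-Ramsey if, for every $G$-invariant coloring $\chi:[X]^2\to\{0,1\}$, there exists $U\in\mathcal{U}$ such that $\chi$ is constant on $[U]^2$. A partition $\mathcal{P}$ of $X$ is $G$-invariant if $gP\in\mathcal{P}$ for all $g\in G$ and $P\in\mathcal{P}$. A free ultrafilter $\mathcal{U}$ on $X$ is $G$-selective if, for every $G$-invariant partition $\mathcal{P}$ of $X$, either some cell of $\mathcal{P}$ is a member of $\mathcal{U}$, or there exists $U\in\mathcal{U}$ such that $|P\cap U|\leqslant 1$ for each $P\in\mathcal{P}$. *)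

(* Defs.v *)
From mathcomp Require Import all_boot monoid.
From mathcomp Require Import boolp classical_sets functions cardinality filter.

Set Implicit Arguments.
Unset Strict Implicit.
Unset Printing Implicit Defensive.

Local Open Scope classical_set_scope.
Local Open Scope card_scope.

(* The [action] of MathComp's fingroup library is a right action of a finite
   group; here the acting group is arbitrary and acts on the left.  A
   [groupType] carries a choice structure, which every type has under the
   axioms of [boolp]. *)
Definition is_gspace (G : groupType) (X : Type) (act : G -> X -> X) : Prop :=
  (forall x, act 1%g x = x) /\
  (forall g h x, act (g * h)%g x = act g (act h x)).

Definition transitive_gspace (G : groupType) (X : Type) (act : G -> X -> X)
    : Prop :=
  forall x y, exists g, act g x = y.

Definition pairs (X : Type) (A : set X) : set_system X :=
  [set p | p `<=` A /\ p #= `I_2].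

(* A coloring of [pairs setT] is represented by a function on all of [set X];
   its values outside [pairs setT] are never constrained nor used. *)
Definition invariant_coloring (G : groupType) (X : Type) (act : G -> X -> X)
    (chi : set X -> bool) : Prop :=
  forall x y, pairs [set: X] [set x; y] ->
  forall g, chi [set x; y] = chi [set act g x; act g y].

Definition constant_on (X : Type) (chi : set X -> bool) (S : set_system X)
    : Prop :=
  exists c, forall p, S p -> chi p = c.

Definition free_ultrafilter (X : Type) (U : set_system X) : Prop :=
  UltraFilter U /\ ~ exists x, U = principal_filter x.

Definition ramsey (G : groupType) (X : Type) (act : G -> X -> X)
    (U : set_system X) : Prop :=
  free_ultrafilter U /\
  forall chi : set X -> bool, invariant_coloring act chi ->
    exists A, U A /\ constant_on chi (pairs A).

Definition invariant_partition (G : groupType) (X : Type) (act : G -> X -> X)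
    (P : set_system X) : Prop :=
  partition P id [set: X] /\
  forall g C, P C -> P (act g @` C).

Definition selective (G : groupType) (X : Type) (act : G -> X -> X)
    (U : set_system X) : Prop :=
  free_ultrafilter U /\
  forall P : set_system X, invariant_partition act P ->
    (exists C, P C /\ U C) \/
    (exists A, U A /\ forall C, P C -> C `&` A #<= `I_1).

(* Main.v *)
Require Import Defs.
From mathcomp Require Import all_boot monoid.
From mathcomp Require Import boolp classical_sets functions cardinality filter.

Local Open Scope classical_set_scope.
Local Open Scope card_scope.

(** Color a pair by whether it lies inside a single cell of the invariant
    partition; this coloring is invariant. A homogeneous member of the
    ultrafilter either lies inside one cell or meets each cell in at most one
    point. *)

Lemma card_set2 {T : Type} {x y : T} : x <> y -> [set x; y] #= `I_2.
Proof.
move=> xy; apply/eq_cardSP; exists x; first by left.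
rewrite (_ : _ `\ x = [set y]); first exact: card_set1.
by apply/seteqP; split=> [z [[-> /(_ erefl)|->]]|z ->] //; split; [right|move=> /esym].
Qed.

Lemma is_subset1_card_le1 {T : Type} {A : set T} : is_subset1 A -> A #<= `I_1.
Proof.
move=> A1; have [->|/set0P[x Ax]] := eqVneq A set0; first exact: card_ge0.
have /card_eqPle[x1 _] := @card_set1 T x.
by apply: card_le_trans x1; apply: subset_card_le => y Ay; exact: A1.
Qed.

Lemma pairs_set2 {X : Type} {A : set X} {x y : X} :
  A x -> A y -> x <> y -> pairs A [set x; y].
Proof. by move=> Ax Ay xy; split; [move=> _ [] ->|exact: card_set2]. Qed.

(** Translation by [g] carries a cell containing a pair to a cell containing the translated pair,
    and translation by [g^-1] carries it back. Phrasing the color as containment in a cell makes it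
    a function of the set, independent of the order of the two points. *)
Lemma invariant_coloring_partition {G : groupType} {X : Type}
    {act : G -> X -> X} {P : set_system X} :
  is_gspace act -> invariant_partition act P ->
  invariant_coloring act (fun p => `[< exists2 C, P C & p `<=` C >]).
Proof.
move=> [act1 actM] [_ PG] x y _ g; apply: asbool_equiv_eq; split=> -[C PC sC].
  exists (act g @` C); first exact: PG.
  by move=> _ [] ->; apply: imageP; apply: sC; [left|right].
exists (act g^-1%g @` C); first exact: PG.
by move=> _ [] ->; [exists (act g x)|exists (act g y)];
  rewrite -?actM ?mulVg ?act1 //; apply: sC; [left|right].
Qed.

Theorem theorem4 (G : groupType) (X : Type) (act : G -> X -> X)
    (hact : is_gspace act)
    (hinf : infinite_set [set: X])
    (htrans : transitive_gspace act)
    (U : set_system X) :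
  ramsey act U -> selective act U.
Proof.
move=> [Ufree Uramsey]; split=> // P Pinv.
have [[Pcover Ptriv _] _] := Pinv.
have [A [UA [c Ac]]] := Uramsey _ (invariant_coloring_partition hact Pinv).
have [UU _] := Ufree.
case: c => /= in Ac; [left|right].
(* Color [true]: the cell [C] of any point [a] of [A] contains all of [A], hence belongs to [U]. *)
- have [a Aa] := filter_ex UA.
  have [C PC Ca] : cover P id a by rewrite Pcover.
  exists C; split=> //; apply: filterS UA => b Ab.
  have [<-//|ab] := pselect (a = b).
  have /asboolP[D PD sD] := Ac _ (pairs_set2 Aa Ab ab).
  (* The cell [D] containing both [a] and [b] meets [C] at [a], and distinct cells are disjoint. *)
  have -> : C = D by apply: Ptriv => //; exists a; split=> //; apply: sD; left.
  by apply: sD; right.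
(* Color [false]: two distinct points of [A] in one cell [C] would form a pair of color [true]. *)
- exists A; split=> // C PC; apply: is_subset1_card_le1.
  move=> x y [Cx Ax] [Cy Ay]; apply: contrapT => xy.
  have /asboolP := Ac _ (pairs_set2 Ax Ay xy); apply.
  by exists C => // _ [] ->.
Qed.
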